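(* Let $\mathcal{A}\to\mathcal{B}$ be a non-expansive homomorphism of seminormed rings. Then: (i) The Kähler seminorm $\|\ \|_\Omega$ is the maximal $\mathcal{B}$-seminorm on $\Omega_{\mathcal{B}/\mathcal{A}}$ that makes $d_{\mathcal{B}/\mathcal{A}}:\mathcal{B}\to\Omega_{\mathcal{B}/\mathcal{A}}$ a non-expansive $\mathcal{A}$-homomorphism. (ii) $d_{\mathcal{B}/\mathcal{A}}$ is the universal non-expansive $\mathcal{A}$-derivation of $\mathcal{B}$ with values in a seminormed $\mathcal{B}$-module: composition with $d_{\mathcal{B}/\mathcal{A}}$ induces an isomorphism $$\mathrm{Hom}_{\mathcal{B},\mathrm{nonexp}}(\Omega_{\mathcal{B}/\mathcal{A}},M)\xrightarrow{\ \sim\ }\mathrm{Der}_{\mathcal{A},\mathrm{nonexp}}(\mathcal{B},M)$$ for any seminormed $\mathcal{B}$-module $M$.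
   Context: A seminormed ring is a (commutative) ring $\mathcal{A}$ with a function $|\ |:\mathcal{A}\to\mathbb{R}_{\ge0}$ satisfying $|0|=0$, $|x-y|\le\max(|x|,|y|)$, $|1|=1$ and $|xy|\le|x||y|$. A seminormed $\mathcal{A}$-module is an $\mathcal{A}$-module $M$ with $\|\ \|:M\to\mathbb{R}_{\ge0}$ satisfying $\|0\|=0$, $\|m-m'\|\le\max(\|m\|,\|m'\|)$ and $\|am\|\le|a|\,\|m\|$; such $\|\ \|$ is called an $\mathcal{A}$-seminorm. A map $\phi$ is non-expansive if the seminorm of $\phi(x)$ does not exceed the seminorm of $x$ for all $x$. The Kähler seminorm on $\Omega_{\mathcal{B}/\mathcal{A}}$ is $\|x\|_\Omega=\inf\max_i|c_i|_{\mathcal{B}}|b_i|_{\mathcal{B}}$, the infimum being over all finite representations $x=\sum_ic_i\,d_{\mathcal{B}/\mathcal{A}}(b_i)$ with $c_i,b_i\in\mathcal{B}$; in (ii) $\Omega_{\mathcal{B}/\mathcal{A}}$ is provided with it. $\mathrm{Hom}_{\mathcal{B},\mathrm{nonexp}}$ denotes non-expansive $\mathcal{B}$-linear homomorphisms and $\mathrm{Der}_{\mathcal{A},\mathrm{nonexp}}$ denotes non-expansive $\mathcal{A}$-derivations. *)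

(* Defs.v *)
From HB Require Import structures.
From mathcomp Require Import all_boot all_order all_algebra.
From mathcomp Require Import ring_quotient.
From mathcomp Require Import boolp classical_sets functions reals.
From mathcomp Require Import monalg.

Set Implicit Arguments.
Unset Strict Implicit.
Unset Printing Implicit Defensive.

Import Order.TTheory GRing.Theory Num.Theory.
Local Open Scope classical_set_scope.
Local Open Scope ring_scope.

Section Seminorms.
Variable R : realType.

Record ring_seminorm (A : comNzRingType) (n : A -> R) : Prop := RingSeminorm {
  ring_seminorm_ge0 : forall x, 0 <= n x;
  ring_seminorm0 : n 0 = 0;
  ring_seminormB : forall x y, n (x - y) <= Num.max (n x) (n y);
  ring_seminorm1 : n 1 = 1;
  ring_seminormM : forall x y, n (x * y) <= n x * n y }.

Record module_seminorm (A : comNzRingType) (nA : A -> R)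
    (M : lmodType A) (n : M -> R) : Prop := ModuleSeminorm {
  module_seminorm_ge0 : forall m, 0 <= n m;
  module_seminorm0 : n 0 = 0;
  module_seminormB : forall m m', n (m - m') <= Num.max (n m) (n m');
  module_seminormZ : forall a m, n (a *: m) <= nA a * n m }.

Definition nonexpansive (U V : Type) (nU : U -> R) (nV : V -> R) (f : U -> V) :=
  forall x, nV (f x) <= nU x.

End Seminorms.

(* A B-module is regarded as an A-module through phi; B itself is the
   B-module B^o. *)
Definition A_linear (A B : comNzRingType) (phi : {rmorphism A -> B})
    (U V : lmodType B) (f : U -> V) :=
  forall a u v, f (phi a *: u + v) = phi a *: f u + f v.

Definition nonexp_A_hom (R : realType) (A B : comNzRingType)
    (phi : {rmorphism A -> B}) (U V : lmodType B) (f : U -> V)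
    (nU : U -> R) (nV : V -> R) :=
  A_linear phi f /\ nonexpansive nU nV f.

Record derivation (A B : comNzRingType) (phi : {rmorphism A -> B})
    (M : lmodType B) (D : B -> M) : Prop := Derivation {
  derivation_linear : A_linear phi (D : B^o -> M);
  derivation_Leibniz : forall x y, D (x * y) = x *: D y + y *: D x }.

(* The module of Kaehler differentials: the quotient of the free B-module
   {malg B[B]} on symbols << b >> by the submodule generated by the relations
   making b |-> << b >> an A-derivation (given additivity and the Leibniz rule,
   A-linearity amounts to vanishing on phi(A)). *)
Section KahlerModule.
Variables (A B : comNzRingType) (phi : {rmorphism A -> B}).

Inductive kahler_rel : {malg B[B]} -> Prop :=
| kahler_relD b b' : kahler_rel (<< b + b' >> - << b >> - << b' >>)
| kahler_relM b b' :
    kahler_rel (<< b * b' >> - b *: << b' >> - b' *: << b >>)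
| kahler_rel_const a : kahler_rel << phi a >>
| kahler_rel0 : kahler_rel 0
| kahler_rel_lin b u v :
    kahler_rel u -> kahler_rel v -> kahler_rel (b *: u + v).

Definition kahler_relb : pred {malg B[B]} := fun u => `[< kahler_rel u >].

Lemma kahler_relb_zmod : zmod_closed kahler_relb.
Proof.
split=> [|u v /asboolP hu /asboolP hv]; apply/asboolP; first exact: kahler_rel0.
by rewrite -[- v]scaleN1r addrC; apply: kahler_rel_lin.
Qed.

HB.instance Definition _ :=
  GRing.isZmodClosed.Build {malg B[B]} kahler_relb kahler_relb_zmod.

Definition kahler_submod : zmodClosed {malg B[B]} :=
  GRing.ZmodClosed.clone _ kahler_relb _.

Definition kahler : Type := Quotient.quot kahler_submod.
HB.instance Definition _ := GRing.Zmodule.on kahler.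

Definition kahler_pi (u : {malg B[B]}) : kahler :=
  \pi_(Quotient.quot kahler_submod)%qT u.

Definition kahler_scale (b : B) (x : kahler) : kahler :=
  kahler_pi (b *: repr (x : Quotient.quot kahler_submod)).

Lemma kahler_piB : {morph kahler_pi : u v / u - v}.
Proof. exact: (raddfB (\pi_(Quotient.quot kahler_submod)%qT)). Qed.

Lemma kahler_piD : {morph kahler_pi : u v / u + v}.
Proof. exact: (raddfD (\pi_(Quotient.quot kahler_submod)%qT)). Qed.

Lemma kahler_pi_eq u v : (kahler_pi u = kahler_pi v) <-> kahler_rel (u - v).
Proof.
have := Quotient.idealrBE kahler_submod u v.
move=> e; split=> [/eqP|h]; first by rewrite -e => /asboolP.
by apply/eqP; rewrite -e; apply/asboolP.
Qed.

Lemma kahler_reprK (x : kahler) :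
  kahler_pi (repr (x : Quotient.quot kahler_submod)) = x.
Proof. exact: reprK. Qed.

Lemma kahler_piZ b u : kahler_scale b (kahler_pi u) = kahler_pi (b *: u).
Proof.
apply/kahler_pi_eq; rewrite -scalerBr -[_ *: _]addr0.
by apply: kahler_rel_lin kahler_rel0; apply/kahler_pi_eq; rewrite kahler_reprK.
Qed.

Lemma kahler_scalerA a b x :
  kahler_scale a (kahler_scale b x) = kahler_scale (a * b) x.
Proof. by rewrite -(kahler_reprK x) !kahler_piZ scalerA. Qed.

Lemma kahler_scale1r : left_id 1 kahler_scale.
Proof. by move=> x; rewrite -(kahler_reprK x) kahler_piZ scale1r. Qed.

Lemma kahler_scalerDr : right_distributive kahler_scale +%R.
Proof.
move=> b x y; rewrite -(kahler_reprK x) -(kahler_reprK y).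
by rewrite -kahler_piD !kahler_piZ scalerDr kahler_piD.
Qed.

Lemma kahler_scalerDl x :
  {morph kahler_scale^~ x : a b / a + b}.
Proof.
by move=> a b /=; rewrite -(kahler_reprK x) !kahler_piZ scalerDl kahler_piD.
Qed.

HB.instance Definition _ := GRing.Zmodule_isLmodule.Build B kahler
  kahler_scalerA kahler_scale1r kahler_scalerDr kahler_scalerDl.

Definition kahler_d (b : B) : kahler := kahler_pi << b >>.

End KahlerModule.

(* The maximum over the empty representation (of 0) is 0. *)
Definition kahler_seminorm (R : realType) (A B : comNzRingType)
    (phi : {rmorphism A -> B}) (nB : B -> R) (x : kahler phi) : R :=
  inf [set r | exists2 s : seq (B * B),
                 x = \sum_(p <- s) p.1 *: kahler_d phi p.2
               & r = \big[Num.max/0]_(p <- s) (nB p.1 * nB p.2)].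

Arguments kahler_seminorm {R A B} phi nB x.

Definition Hom_nonexp (R : realType) (B : comNzRingType) (U V : lmodType B)
    (nU : U -> R) (nV : V -> R) : set (U -> V) :=
  [set f | linear f /\ nonexpansive nU nV f].

Definition Der_nonexp (R : realType) (A B : comNzRingType)
    (phi : {rmorphism A -> B}) (nB : B -> R) (M : lmodType B) (nM : M -> R) :
    set (B -> M) :=
  [set D | derivation phi D /\ nonexpansive nB nM D].

(* Sets of non-expansive maps are not B-submodules in general, only modules
   over the unit ball of B, which contains -1. *)
Definition ball_submodule (R : realType) (B : comNzRingType) (nB : B -> R)
    (V : lmodType B) (S : set V) :=
  S 0 /\ forall b u v, nB b <= 1 -> S u -> S v -> S (b *: u + v).

Definition ball_module_iso (R : realType) (B : comNzRingType) (nB : B -> R)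
    (U V : lmodType B) (S : set U) (T : set V) (F : U -> V) :=
  [/\ ball_submodule nB S, ball_submodule nB T,
      (forall b u v, nB b <= 1 -> S u -> S v ->
         F (b *: u + v) = b *: F u + F v)
    & set_bij S T F].

(* Main.v *)
(* A seminorm is non-archimedean, so any seminorm making d non-expansive, or
   pulled back along a linear map f with f \o d non-expansive, is bounded at
   \sum_i c_i *: d b_i by the maximum of the |c_i| |b_i|, hence by the infimum of
   these maxima. Maximality and the non-expansiveness of the factorization of a
   derivation are both instances of this bound. *)
Require Import Defs.
From HB Require Import structures.
From mathcomp Require Import all_boot all_order all_algebra.
From mathcomp Require Import finmap.
From mathcomp Require Import boolp classical_sets functions reals.
From mathcomp Require Import monalg.

Import Order.TTheory GRing.Theory Num.Theory.
Local Open Scope classical_set_scope.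
Local Open Scope ring_scope.

(** * Universal property of the free module *)

Section MalgEval.
Context {K : choiceType} {B : comNzRingType} {M : lmodType B}.
Implicit Types (D : K -> M) (u v : {malg B[K]}).

(** The linear extension of [D] to the free module on [K]. *)
Definition malg_eval D u : M := \sum_(k <- msupp u) u@_k *: D k.

(** Coefficients vanish off the support. Linearity needs this to compare sums with different
    supports over one common index set. *)
Lemma malg_evalEw D u (d : {fset K}) :
  (msupp u `<=` d)%fset -> malg_eval D u = \sum_(k <- d) u@_k *: D k.
Proof.
move=> ud; apply: big_fset_incl => // k _ ku.
by rewrite mcoeff_outdom // scale0r.
Qed.

Lemma malg_eval_linear D : linear (malg_eval D).
Proof.
move=> a u v; pose d := (msupp u `|` msupp v)%fset.
rewrite (malg_evalEw D u d) ?fsubsetUl // (malg_evalEw D v d) ?fsubsetUr //.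
rewrite (malg_evalEw D (a *: u + v) d); last first.
  by rewrite (fsubset_trans (msuppD_le _ _)) // fsetSU // msuppZ_le.
rewrite scaler_sumr -big_split; apply: eq_bigr => k _.
by rewrite mcoeffD mcoeffZ scalerDl scalerA.
Qed.

HB.instance Definition _ D :=
  GRing.isLinear.Build B {malg B[K]} M *:%R (malg_eval D) (malg_eval_linear D).

Lemma malg_evalU1 D k : malg_eval D << k >> = D k.
Proof.
by rewrite /malg_eval msuppU oner_eq0 big_seq_fset1 mcoeffUU scale1r.
Qed.

Lemma malgE_scale u : u = \sum_(k <- msupp u) u@_k *: << k >>.
Proof.
rewrite [LHS]monalgE; apply: eq_bigr => k _; apply/malgP => k'.
by rewrite mcoeffZ !mcoeffU mulrnAr mulr1.
Qed.

End MalgEval.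

(** * Derivations and the algebraic universal property of Kaehler differentials *)

Section Derivations.
Context {A B : comNzRingType} {phi : {rmorphism A -> B}}.

Lemma derivationD {M : lmodType B} {D : B -> M} (hD : derivation phi D) :
  {morph D : x y / x + y}.
Proof.
by move=> x y; have := derivation_linear hD 1 x y; rewrite rmorph1 !scale1r.
Qed.

(** The Leibniz rule at [1 * 1] gives [D 1 = D 1 + D 1]. *)
Lemma derivation1 {M : lmodType B} {D : B -> M} (hD : derivation phi D) :
  D 1 = 0.
Proof.
apply: (addrI (D 1)).
by rewrite -{1 2}(scale1r (D 1)) -(derivation_Leibniz hD) mulr1 addr0.
Qed.

(** Scaling in [B^o] is multiplication, so A-linearity turns [D (phi a * 1)] into [phi a *: D 1]. *)
Lemma derivation_const {M : lmodType B} {D : B -> M} (hD : derivation phi D) a :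
  D (phi a) = 0.
Proof.
have D0 : D 0 = 0 by apply: (addrI (D 0)); rewrite -(derivationD hD) !addr0.
have := derivation_linear hD a 1 0.
by rewrite D0 !addr0 (derivation1 hD) scaler0 /GRing.scale /= mulr1.
Qed.

Lemma kahler_pi_linear : linear (kahler_pi phi).
Proof. by move=> a u v; rewrite kahler_piD -kahler_piZ. Qed.

HB.instance Definition _ := GRing.isLinear.Build B {malg B[B]} (kahler phi)
  *:%R (kahler_pi phi) kahler_pi_linear.

Lemma kahler_pi0 u : kahler_rel phi u -> kahler_pi phi u = 0.
Proof.
move=> hu; rewrite -(linear0 (kahler_pi phi)).
by apply/kahler_pi_eq; rewrite subr0.
Qed.

Lemma kahler_d_derivation : derivation phi (kahler_d phi).
Proof.
have dD b b' : kahler_d phi (b + b') = kahler_d phi b + kahler_d phi b'.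
  apply/eqP; rewrite -subr_eq0 opprD addrA -!kahler_piB.
  by rewrite kahler_pi0 //; apply: kahler_relD.
have dM x y : kahler_d phi (x * y) = x *: kahler_d phi y + y *: kahler_d phi x.
  apply/eqP; rewrite -subr_eq0 opprD addrA /kahler_d.
  rewrite -!(linearZZ (kahler_pi phi)) -!kahler_piB.
  by rewrite kahler_pi0 //; apply: kahler_relM.
split=> // a u v.
rewrite dD dM (_ : kahler_d phi (phi a) = 0) ?scaler0 ?addr0 //.
by apply: kahler_pi0; apply: kahler_rel_const.
Qed.

(** Besides giving uniqueness of factorizations, this makes the set whose infimum defines the
    Kaehler seminorm nonempty. *)
Lemma kahler_span (x : kahler phi) :
  exists s : seq (B * B), x = \sum_(p <- s) p.1 *: kahler_d phi p.2.
Proof.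
rewrite -(kahler_reprK x); set u := repr _.
exists [seq (u@_k, k) | k <- msupp u].
rewrite big_map [X in kahler_pi _ X]malgE_scale linear_sum.
by apply: eq_bigr => k _; rewrite linearZ.
Qed.

Lemma kahler_linear_ext {M : lmodType B} (f g : kahler phi -> M) :
  linear f -> linear g -> f \o kahler_d phi =1 g \o kahler_d phi -> f =1 g.
Proof.
move=> lf lg fg x.
pose F : {linear kahler phi -> M} :=
  HB.pack f (GRing.isLinear.Build B _ M *:%R f lf).
pose G : {linear kahler phi -> M} :=
  HB.pack g (GRing.isLinear.Build B _ M *:%R g lg).
have [s ->] := kahler_span x.
rewrite -[LHS]/(F _) -[RHS]/(G _) !linear_sum; apply: eq_bigr => p _.
by rewrite !linearZ; congr (_ *: _); apply: fg.
Qed.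

Section Lift.
Context {M : lmodType B} {D : B -> M}.
Hypothesis hD : derivation phi D.

(** Each generating relation is killed by the matching property of [D]; the closure rules follow by
    linearity of evaluation. *)
Lemma malg_eval_kahler_rel u : kahler_rel phi u -> malg_eval D u = 0.
Proof.
elim=> [b b'|b b'|a||b v w _ IHv _ IHw].
- by rewrite !linearB /= !malg_evalU1 (derivationD hD) addrAC addrK subrr.
- rewrite !linearB !linearZ /= !malg_evalU1 (derivation_Leibniz hD).
  by rewrite !scalerN addrAC addrK subrr.
- by rewrite malg_evalU1 (derivation_const hD).
- exact: linear0.
- by rewrite malg_eval_linear IHv IHw scaler0 addr0.
Qed.

Lemma kahler_lift :
  exists f : {linear kahler phi -> M}, f \o kahler_d phi = D.
Proof.
pose f (x : kahler phi) :=
  malg_eval D (repr (x : Quotient.quot (kahler_submod phi))).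
(* The chosen representative is immaterial: it differs from [u] by a relation, which evaluates to
   0. *)
have fpi u : f (kahler_pi phi u) = malg_eval D u.
  apply/eqP; rewrite -subr_eq0 -linearB; apply/eqP/malg_eval_kahler_rel.
  by apply/kahler_pi_eq; rewrite kahler_reprK.
have lf : linear f.
  move=> a x y; rewrite -(kahler_reprK x) -(kahler_reprK y).
  by rewrite -(linearP (kahler_pi phi)) !fpi linearP.
pose F : {linear kahler phi -> M} :=
  HB.pack f (GRing.isLinear.Build B _ M *:%R f lf).
exists F.
by apply/funext => b /=; rewrite fpi malg_evalU1.
Qed.

End Lift.

Lemma derivation_comp {M : lmodType B} (f : kahler phi -> M) :
  linear f -> derivation phi (f \o kahler_d phi).
Proof.
move=> lf.
pose F : {linear kahler phi -> M} :=
  HB.pack f (GRing.isLinear.Build B _ M *:%R f lf).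
have [dl dM] := kahler_d_derivation.
split=> [a u v|x y] /=.
  by rewrite dl lf.
by rewrite dM lf -[f (y *: _)]/(F _) linearZ.
Qed.

Lemma derivation_lincomb {M : lmodType B} (b : B) (D E : B -> M) :
  derivation phi D -> derivation phi E -> derivation phi (b *: D + E).
Proof.
move=> [lD MD] [lE ME]; split=> [a u v|x y]; rewrite !fctE.
  by rewrite lD lE !scalerDr !scalerA mulrC addrACA.
by rewrite MD ME !scalerDr !scalerA ![_ * b]mulrC addrACA.
Qed.

Lemma derivation_zero {M : lmodType B} : derivation phi (0 : B -> M).
Proof.
have E x : (0 : B -> M) x = 0 by [].
by split=> [a u v|x y]; rewrite !E !scaler0 addr0.
Qed.

End Derivations.

(** * Ultrametric bounds for module seminorms *)

Section Seminorms.
Context {R : realType} {B : comNzRingType} {nB : B -> R}.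
Hypothesis hB : ring_seminorm nB.

(** The difference 0 - 1 gives |-1| <= 1; conversely 1 = |(-1)(-1)| <= |-1| |-1| <= |-1|. *)
Lemma ring_seminormN1 : nB (- 1) = 1.
Proof.
have le1 : nB (- 1) <= 1.
  have := ring_seminormB hB 0 1.
  by rewrite sub0r (ring_seminorm0 hB) (ring_seminorm1 hB) (max_r ler01).
apply/eqP; rewrite eq_le le1 /=.
have := ring_seminormM hB (- 1) (- 1).
rewrite mulrNN mulr1 (ring_seminorm1 hB) => /le_trans; apply.
by rewrite ler_piMr // (ring_seminorm_ge0 hB).
Qed.

Section Modules.
Context {M : lmodType B} {nM : M -> R}.
Hypothesis hM : module_seminorm nB nM.

Lemma module_seminormD m m' : nM (m + m') <= Num.max (nM m) (nM m').
Proof.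
have := module_seminormB hM m (- m'); rewrite opprK => /le_trans; apply.
rewrite ge_max le_max lexx /= le_max; apply/orP; right.
rewrite -scaleN1r; apply: le_trans (module_seminormZ hM _ _) _.
by rewrite ring_seminormN1 mul1r.
Qed.

(** The bounds [r i] are left free so that the norm of the image of d b in any module can be
    replaced by |b|. *)
Lemma module_seminorm_sum {I : Type} (s : seq I) (c : I -> B) (m : I -> M)
    (r : I -> R) :
  (forall i, nM (m i) <= r i) ->
  nM (\sum_(i <- s) c i *: m i) <= \big[Num.max/0]_(i <- s) (nB (c i) * r i).
Proof.
move=> mr; elim: s => [|i s IHs].
  by rewrite !big_nil (module_seminorm0 hM).
rewrite !big_cons; apply: le_trans (module_seminormD _ _) _.
rewrite ge_max !le_max IHs orbT andbT (le_trans (module_seminormZ hM _ _)) //.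
by rewrite ler_wpM2l // (ring_seminorm_ge0 hB).
Qed.

Lemma nonexpansive_lincomb {U : Type} {nU : U -> R} (b : B) (f g : U -> M) :
  nB b <= 1 -> nonexpansive nU nM f -> nonexpansive nU nM g ->
  nonexpansive nU nM (b *: f + g).
Proof.
move=> b1 hf hg x; rewrite !fctE; apply: le_trans (module_seminormD _ _) _.
rewrite ge_max hg andbT (le_trans (module_seminormZ hM _ _)) //.
by rewrite (le_trans _ (hf x)) // ler_piMl // (module_seminorm_ge0 hM).
Qed.

End Modules.

(** * The Kaehler seminorm and its maximality *)

Section Kahler.
Context {A : comNzRingType} {phi : {rmorphism A -> B}}.
Implicit Types (x y : kahler phi) (s t : seq (B * B)).

Let rsize s : R := \big[Num.max/0]_(p <- s) (nB p.1 * nB p.2).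
Let rsum s : kahler phi := \sum_(p <- s) p.1 *: kahler_d phi p.2.

Lemma rsize_ge0 s : 0 <= rsize s.
Proof. exact: bigmax_ge_id. Qed.

Lemma rsize_cat s t : rsize (s ++ t) = Num.max (rsize s) (rsize t).
Proof.
rewrite /rsize; elim: s => [|p s IHs].
  by rewrite big_nil max_r // bigmax_ge_id.
by rewrite cat_cons !big_cons IHs maxA.
Qed.

(** Multiplication by |b| >= 0 commutes with maxima; submultiplicativity of [nB] leaves only an
    inequality. *)
Lemma rsize_scale b s :
  rsize [seq (b * p.1, p.2) | p <- s] <= nB b * rsize s.
Proof.
have b0 := ring_seminorm_ge0 hB b.
rewrite /rsize big_map; elim: s => [|p s IHs]; first by rewrite !big_nil mulr0.
rewrite !big_cons maxr_pMr // ge_max !le_max IHs orbT andbT mulrA.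
by rewrite ler_wpM2r ?(ring_seminorm_ge0 hB) // (ring_seminormM hB).
Qed.

Lemma rsum_scale b s :
  rsum [seq (b * p.1, p.2) | p <- s] = b *: rsum s.
Proof.
by rewrite /rsum big_map scaler_sumr; apply: eq_bigr => p _; rewrite scalerA.
Qed.

Lemma kahler_seminorm_le s : kahler_seminorm phi nB (rsum s) <= rsize s.
Proof.
apply: ge_inf; last by exists s.
by exists 0 => _ [t _ ->]; apply: rsize_ge0.
Qed.

Lemma kahler_seminorm_glb x c :
  (forall s, x = rsum s -> c <= rsize s) -> c <= kahler_seminorm phi nB x.
Proof.
move=> h; apply: lb_le_inf => [|_ [s xs ->]]; last exact: h.
by have [s xs] := kahler_span x; exists (rsize s), s.
Qed.

(** The infimum need not be attained, but any strict upper bound is beaten by an actual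
    representation. *)
Lemma kahler_seminorm_lt x c :
  kahler_seminorm phi nB x < c -> exists2 s, x = rsum s & rsize s < c.
Proof.
move=> /inf_lt[|_ [s xs ->] sc]; last by exists s.
by have [s xs] := kahler_span x; exists (rsize s), s.
Qed.

Lemma kahler_seminorm_module : module_seminorm nB (kahler_seminorm phi nB).
Proof.
have ge0 x : 0 <= kahler_seminorm phi nB x.
  by apply: kahler_seminorm_glb => s _; apply: rsize_ge0.
split=> [//||x y|b x].
(* The empty representation of 0 has size 0. *)
- apply/eqP; rewrite eq_le ge0 andbT.
  by have := kahler_seminorm_le [::]; rewrite /rsum /rsize !big_nil.
(* If x and y both had seminorm below that of x - y, each would have a representation of size below
   it. Concatenating the first with the negated second represents x - y by something smaller than
   its own seminorm. *)
- rewrite leNgt gt_max; apply/negP => /andP[].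
  move=> /kahler_seminorm_lt[s xs ltxs] /kahler_seminorm_lt[t yt ltyt].
  suff /le_lt_trans : kahler_seminorm phi nB (x - y) <=
      Num.max (rsize s) (rsize t).
    by move=> /(_ (kahler_seminorm phi nB (x - y)));
      rewrite gt_max ltxs ltyt ltxx => /(_ isT).
  have -> : x - y = rsum (s ++ [seq (-1 * p.1, p.2) | p <- t]).
    by rewrite /rsum big_cat -/(rsum s) -/(rsum _) rsum_scale scaleN1r -xs -yt.
  apply: le_trans (kahler_seminorm_le _) _; rewrite rsize_cat.
  rewrite ge_max !le_max lexx /=.
  by rewrite -[rsize t]mul1r -ring_seminormN1 rsize_scale orbT.
- have le_rep s : x = rsum s ->
      kahler_seminorm phi nB (b *: x) <= nB b * rsize s.
    move=> ->; rewrite -rsum_scale.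
    exact: le_trans (kahler_seminorm_le _) (rsize_scale _ _).
  (* Passing to the infimum over [s] divides by |b|; when |b| = 0 a single representation already
     gives the bound 0. *)
  have := ring_seminorm_ge0 hB b; rewrite le_eqVlt => /predU1P[b0|b0].
    have [s xs] := kahler_span x.
    by have := le_rep s xs; rewrite -b0 !mul0r.
  rewrite mulrC -ler_pdivrMr //; apply: kahler_seminorm_glb => s xs.
  by rewrite ler_pdivrMr // mulrC le_rep.
Qed.

Lemma kahler_d_nonexpansive :
  nonexpansive nB (kahler_seminorm phi nB) (kahler_d phi).
Proof.
(* The one-term representation 1 d b has size |1| |b| = |b|. *)
move=> b; have := kahler_seminorm_le [:: (1, b)].
rewrite /rsum /rsize !big_cons !big_nil /= addr0 scale1r.
rewrite (ring_seminorm1 hB) mul1r.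
by rewrite max_l // (ring_seminorm_ge0 hB).
Qed.

Lemma kahler_seminorm_max {M : lmodType B} {nM : M -> R}
    (f : {linear kahler phi -> M}) :
  module_seminorm nB nM -> nonexpansive nB nM (f \o kahler_d phi) ->
  nonexpansive (kahler_seminorm phi nB) nM f.
Proof.
move=> hM hf x; apply: kahler_seminorm_glb => s ->.
rewrite linear_sum; under eq_bigr do rewrite linearZ /=.
by apply: (module_seminorm_sum hM) => p; apply: hf.
Qed.

End Kahler.
End Seminorms.

Theorem lemma4p1p3 (R : realType) (A B : comNzRingType)
    (nA : A -> R) (nB : B -> R)
    (hA : ring_seminorm nA) (hB : ring_seminorm nB)
    (phi : {rmorphism A -> B}) (hphi : nonexpansive nA nB phi) :
  [/\ module_seminorm nB (kahler_seminorm phi nB),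
      nonexp_A_hom phi (kahler_d phi : B^o -> kahler phi)
        nB (kahler_seminorm phi nB)
    & forall n : kahler phi -> R,
        module_seminorm nB n ->
        nonexp_A_hom phi (kahler_d phi : B^o -> kahler phi) nB n ->
        forall x, n x <= kahler_seminorm phi nB x] /\
  (Der_nonexp phi nB (kahler_seminorm phi nB) (kahler_d phi) /\
   forall (M : lmodType B) (nM : M -> R), module_seminorm nB nM ->
     ball_module_iso nB
       (Hom_nonexp (kahler_seminorm phi nB) nM)
       (Der_nonexp phi nB nM)
       (fun f : kahler phi -> M => f \o kahler_d phi)).
Proof.
have dd : derivation phi (kahler_d phi) := kahler_d_derivation.
have dne := @kahler_d_nonexpansive R B nB hB A phi.
split.
  split; first exact: kahler_seminorm_module.
  - by split=> //; apply: derivation_linear dd.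
  (* Maximality is the bound for the identity map into the same module with the seminorm [n]. *)
  - by move=> n hn [_ hd]; apply: (kahler_seminorm_max hB idfun hn).
split=> // M nM hM.
have nM0 (U : Type) (nU : U -> R) : (forall x, 0 <= nU x) ->
    nonexpansive nU nM (0 : U -> M).
  by move=> nU0 x; rewrite -[X in nM X]/(0 : M) (module_seminorm0 hM).
split=> //.
- split=> [|b f g b1 [lf hf] [lg hg]].
    split=> [a u v|].
      by rewrite -[RHS]/(a *: 0 + 0 : M) scaler0 addr0.
    exact/nM0/(module_seminorm_ge0 (kahler_seminorm_module hB)).
  split; last exact: (nonexpansive_lincomb hB hM).
  move=> a u v; rewrite !fctE lf lg !scalerDr !scalerA [a * b]mulrC.
  exact: addrACA.
- split=> [|b D E b1 [dD hD] [dE hE]].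
    by split; [exact: derivation_zero | exact/nM0/(ring_seminorm_ge0 hB)].
  by split; [exact: derivation_lincomb | exact: (nonexpansive_lincomb hB hM)].
split.
- move=> f [lf hf]; split; first exact: derivation_comp.
  by move=> b; apply: le_trans (hf _) (dne _).
(* Injectivity: the elements d b generate. *)
- move=> f g /set_mem[lf _] /set_mem[lg _] fg; apply/funext.
  by apply: kahler_linear_ext => // b; rewrite fg.
(* Surjectivity: the algebraic factorization is non-expansive because its composite with d is
   [D]. *)
- move=> D [dD hD]; have [f fD] := kahler_lift dD.
  exists (f : kahler phi -> M) => //; split; first exact: linearP.
  by apply: (kahler_seminorm_max hB _ hM); rewrite fD.
Qed.
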